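(* Let $G(V,E)$ be a graph on $n$ vertices with $\mathrm{MM}(G)=\omega(k\log n)$, and let $G^{(1)},\ldots,G^{(k)}$ be a random $k$-partition of $G$. Then the algorithm that outputs any maximum matching of $G^{(i)}$ is a $(3+o(1))$-approximation randomized composable coreset of size $O(n)$ for the maximum matching problem; i.e., for arbitrary maximum matchings $M_i$ of $G^{(i)}$, $i\in[k]$, with high probability the graph with edge set $M_1\cup\cdots\cup M_k$ contains a matching of size at least $\mathrm{MM}(G)/(3+o(1))$.
   Context: $\mathrm{MM}(G)$ denotes the size of a maximum matching of $G$. A random $k$-partition of $G(V,E)$ sends each edge independently to one of $k$ edge sets $E^{(1)},\ldots,E^{(k)}$ chosen uniformly at random, with $G^{(i)}=(V,E^{(i)})$. An $\alpha$-approximation randomized composable coreset for matching is an algorithm ALG returning a subgraph such that, for a random $k$-partition, the maximum matching of $\mathrm{ALG}(G^{(1)})\cup\cdots\cup\mathrm{ALG}(G^{(k)})$ has size at least $\mathrm{MM}(G)/\alpha$ with high probability; its size is the number of edges returned. *)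

(* Defs.v *)
From HB Require Import structures.
From mathcomp Require Import all_boot all_order all_algebra.
From mathcomp Require Import all_classical all_reals all_analysis.

Set Implicit Arguments.
Unset Strict Implicit.
Unset Printing Implicit Defensive.

Import Order.TTheory GRing.Theory Num.Theory.
Import numFieldNormedType.Exports.

Local Open Scope ring_scope.

(* A graph on the vertex set V is identified with its set of edges. *)
Definition simple_graph (V : finType) (E : {set {set V}}) : bool :=
  [forall e in E, #|e| == 2%N].

Definition is_matching (V : finType) (E M : {set {set V}}) : bool :=
  (M \subset E) && finset.trivIset M.

Definition MM (V : finType) (E : {set {set V}}) : nat :=
  \max_(M : {set {set V}} | is_matching E M) #|M|.

Definition is_maximum_matching (V : finType) (E M : {set {set V}}) : bool :=
  is_matching E M && (#|M| == MM E).

Section RandomPartition.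
Variables (R : realType) (V : finType) (E : {set {set V}}) (k : nat).

Definition edge_assignment := {ffun {e : {set V} | e \in E} -> 'I_k}.

Definition part (sigma : edge_assignment) (i : 'I_k) : {set {set V}} :=
  [set val e | e : {e : {set V} | e \in E} & sigma e == i]%SET.

(* Product law: independently for every edge, each index has probability 1/k. *)
Definition Pr_partition (A : pred edge_assignment) : R :=
  \sum_(sigma : edge_assignment | A sigma)
    \prod_(e : {e : {set V} | e \in E}) (k%:R)^-1.

End RandomPartition.

(* [ALG V E H] : H is a possible output on input (V, E).  Outputs are a
   relation and not a function so that "any maximum matching" is one
   algorithm, whose ties are broken arbitrarily. *)
Definition algorithm : Type :=
  forall V : finType, {set {set V}} -> {set {set V}} -> bool.

Definition maximum_matching_alg : algorithm := is_maximum_matching.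

Definition returns_subgraph (ALG : algorithm) : Prop :=
  forall (V : finType) (E : {set {set V}}), simple_graph E ->
    (exists H, ALG V E H) /\ (forall H, ALG V E H -> H \subset E).

Definition size_O_n (ALG : algorithm) : Prop :=
  exists C : nat, forall (V : finType) (E H : {set {set V}}),
    simple_graph E -> ALG V E H -> (#|H| <= C * #|V|)%N.

(* Every choice of outputs on the k parts, even one depending on the whole
   partition, yields a union with a matching of size MM(G) / a. *)
Definition good_partition (R : realType) (ALG : algorithm) (a : R)
    (V : finType) (E : {set {set V}}) (k : nat) : pred (edge_assignment E k) :=
  fun sigma =>
    [forall H : {ffun 'I_k -> {set {set V}}},
      [forall i, ALG V (part sigma i) (H i)] ==>
      ((MM E)%:R / a <= (MM (\bigcup_(i < k) H i)%SET)%:R)].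

Local Open Scope classical_set_scope.

(* Graphs and values of k are restricted to those satisfying [promise]; alpha
   depends on the number n of vertices.  With high probability: for every
   constant c, probability at least 1 - n^-c for n large enough, uniformly in
   the graph and in k. *)
Definition randomized_composable_coreset (R : realType)
    (promise : forall V : finType, {set {set V}} -> nat -> Prop)
    (alpha : nat -> R) (ALG : algorithm) : Prop :=
  returns_subgraph ALG /\
  forall c : nat, \forall n \near \oo,
    forall (V : finType) (E : {set {set V}}) (k : nat),
      #|V| = n -> simple_graph E -> (0 < k)%N -> promise V E k ->
      1 - (n%:R ^+ c)^-1 <=
        Pr_partition R (@good_partition R ALG (alpha n) V E k).

(* Main.v *)
Require Import Defs.
From HB Require Import structures.
From mathcomp Require Import all_boot all_order all_algebra.
From mathcomp Require Import all_classical all_reals all_analysis.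
From mathcomp Require Import ring lra.

Set Implicit Arguments.
Unset Strict Implicit.
Unset Printing Implicit Defensive.

Import Order.TTheory GRing.Theory Num.Theory.
Import numFieldNormedType.Exports.

Local Open Scope ring_scope.

(** Fix a maximum matching [M*] of [G], of size [m], and let [M_i] be a maximum
    matching of [G^(i)]. Conditionally on the edges of [G^(i)] outside [M*],
    [MM(G^(i))] is a 1-Lipschitz function of the independent membership bits
    (each of bias [1/k]) of the edges of [M*], so with high probability it is
    at least its conditional mean minus [e m / k]. With [K_i = M_i \ M*], that
    mean is at least [|K_i| + (m - 2 |K_i|) / k]: keep [K_i] and add the edges
    of [M*] that avoid it and fall into [G^(i)]. Hence
    [|M_i /\ M*| >= (m - 2 h) / k - e m / k], where [h] is the size of a maximum
    matching of the union of the [M_i]. The sets [M_i /\ M*] are disjoint and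
    their union is a matching, so summing over [i] gives [h >= m - 2 h - e m]. *)

(** * Uniform colorings: conditional means and a lower-tail bound *)

Section Resampling.
Variables (R : realType) (T : finType) (k : nat).
Implicit Types (f g : {ffun T -> 'I_k}) (F G : {ffun T -> 'I_k} -> R).
Implicit Types (x y : T) (a b i : 'I_k) (s : seq T).

Definition recolor f x a : {ffun T -> 'I_k} :=
  [ffun y => if y == x then a else f y].

Lemma recolorC f x y a b : x != y ->
  recolor (recolor f x a) y b = recolor (recolor f y b) x a.
Proof.
move=> xy; apply/ffunP => z; rewrite !ffunE.
by case: eqVneq => // ->; rewrite eq_sym (negPf xy).
Qed.

Lemma recolor_recolor f x a b : recolor (recolor f x a) x b = recolor f x b.
Proof. by apply/ffunP => z; rewrite !ffunE; case: eqP. Qed.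

Lemma recolor_id f x : recolor f x (f x) = f.
Proof. by apply/ffunP => z; rewrite !ffunE; case: eqP => // ->. Qed.

Definition avg1 x F f : R := k%:R^-1 * \sum_a F (recolor f x a).

(* The conditional expectation of [F] given the colors outside [s]. *)
Definition avg s F : {ffun T -> 'I_k} -> R := foldr avg1 F s.

(** The weight is kept as the product occurring in [Pr_partition], so that probabilities become
    means of indicators term by term. *)
Definition mean F : R := \sum_f (\prod_(x : T) k%:R^-1) * F f.

Lemma avg1_le x F G : (forall f, F f <= G f) -> forall f, avg1 x F f <= avg1 x G f.
Proof.
by move=> FG f; rewrite /avg1 ler_wpM2l ?invr_ge0 ?ler0n// ler_sum.
Qed.

Lemma avg_le s F G : (forall f, F f <= G f) -> forall f, avg s F f <= avg s G f.
Proof. by move=> FG; elim: s => //= x s IH; apply: avg1_le. Qed.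

Lemma mean_le F G : (forall f, F f <= G f) -> mean F <= mean G.
Proof.
move=> FG; apply: ler_sum => f _; rewrite ler_wpM2l//.
by apply: prodr_ge0 => x _; rewrite invr_ge0 ler0n.
Qed.

Lemma avg_sum s (I : finType) (P : pred I) (F : I -> {ffun T -> 'I_k} -> R) f :
  avg s (fun g => \sum_(j | P j) F j g) f = \sum_(j | P j) avg s (F j) f.
Proof.
elim: s f => //= x s IH f; rewrite /avg1.
by rewrite (eq_bigr _ (fun a _ => IH _)) exchange_big/= mulr_sumr.
Qed.

Hypothesis k_gt0 : (0 < k)%N.

Let k_neq0 : k%:R != 0 :> R. Proof. by rewrite pnatr_eq0 -lt0n. Qed.

Lemma avg1_const (c : R) x F f :
  (forall a, F (recolor f x a) = c) -> avg1 x F f = c.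
Proof.
move=> Fc; rewrite /avg1; under eq_bigr do rewrite Fc.
by rewrite sumr_const card_ord -[c *+ k]mulr_natl mulKf.
Qed.

(** Exchanging the color of [x] with the fresh color is an involution on pairs (coloring, color);
    reindexing along it removes the fresh color from the summand. *)
Lemma mean_avg1 x F : mean (avg1 x F) = mean F.
Proof.
rewrite /mean -[LHS]mulr_sumr -[RHS]mulr_sumr; congr (_ * _).
rewrite /avg1 -mulr_sumr pair_bigA/=.
pose h (p : {ffun T -> 'I_k} * 'I_k) := (recolor p.1 x p.2, p.1 x).
have hK : involutive h.
  by move=> [f a]; rewrite /h/= recolor_recolor recolor_id ffunE eqxx.
rewrite (reindex_inj (inv_inj hK))/=.
under eq_bigr do rewrite recolor_recolor recolor_id.
rewrite -(pair_bigA _ (fun f (a : 'I_k) => F f))/=.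
under eq_bigr do rewrite sumr_const card_ord -[_ *+ k]mulr_natl.
by rewrite -mulr_sumr mulKf.
Qed.

Lemma mean_avg s F : mean (avg s F) = mean F.
Proof. by elim: s => //= x s IH; rewrite mean_avg1. Qed.

Lemma mean_cst (c : R) : mean (fun=> c) = c.
Proof.
rewrite /mean sumr_const card_ffun card_ord prodr_const -[LHS]mulr_natl natrX.
by rewrite mulrA -exprMn divff// expr1n mul1r.
Qed.

Lemma avg_recolor s F f x a : x \in s -> avg s F (recolor f x a) = avg s F f.
Proof.
elim: s f => //= y s IH f; rewrite inE.
have [-> _|xy /= xs] := eqVneq x y; rewrite /avg1.
  by under eq_bigr do rewrite recolor_recolor.
by under eq_bigr do rewrite recolorC// IH//.
Qed.

(** A factor determined by the colors outside [s] is a constant for the conditional expectation. *)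
Lemma avg_mulr s F G f :
  (forall g x a, x \in s -> G (recolor g x a) = G g) ->
  avg s (fun g => F g * G g) f = avg s F f * G f.
Proof.
elim: s f => //= x s IH f Gs; rewrite /avg1.
under eq_bigr => a _.
  rewrite IH; last by move=> g y b ys; rewrite Gs// inE ys orbT.
  rewrite Gs ?mem_head//; over.
by rewrite -mulr_suml mulrA.
Qed.

Lemma avg_color s x i f :
  avg s (fun g => (g x == i)%:R) f =
  if x \in s then k%:R^-1 else (f x == i)%:R.
Proof.
elim: s f => //= y s IH f; rewrite inE.
have [xs|xs] := boolP (x \in s).
  by rewrite orbT; apply: avg1_const => a; rewrite IH xs.
rewrite orbF /avg1; under eq_bigr do rewrite IH (negPf xs) ffunE.
have [_|xy] := eqVneq x y.
  rewrite (bigD1 i)//= eqxx big1 ?addr0 ?mulr1// => a /negPf ->.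
  by [].
by rewrite sumr_const card_ord -[X in _ * X]mulr_natl mulKf.
Qed.

(** A nondecreasing 1-Lipschitz function of the bits [f x == i]: colors other than [i] are
    interchangeable. *)
Definition color_lipschitz i F : Prop := forall f x,
  (forall a b, a != i -> b != i -> F (recolor f x a) = F (recolor f x b)) /\
  (forall a, a != i -> 0 <= F (recolor f x i) - F (recolor f x a) <= 1).

(** Resampling [y] erases any recoloring of [y] and commutes with recoloring another point, where
    the increment becomes a mean of [k] increments in [0, 1]. *)
Lemma color_lipschitz_avg s i F :
  color_lipschitz i F -> color_lipschitz i (avg s F).
Proof.
move=> LF; elim: s => //= y s IH f x.
have [->|xy] := eqVneq x y.
  have avgE a b : avg1 y (avg s F) (recolor f y a) = avg1 y (avg s F) (recolor f y b).
    by rewrite /avg1; under eq_bigr do rewrite recolor_recolor;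
       under [in RHS]eq_bigr do rewrite recolor_recolor.
  by split=> [a b _ _|a _]; rewrite ?(avgE i a) ?subrr ?lexx ?ler01//; exact: avgE.
split=> [a b ai bi|a ai]; rewrite /avg1.
  congr (_ * _); apply: eq_bigr => c _; rewrite 2?[recolor (recolor f x _) _ _]recolorC//.
  by have [/(_ _ _ ai bi)] := IH (recolor f y c) x.
rewrite -mulrBr -sumrB; set S := \sum_(_ | _) _.
have S0 : 0 <= S.
  apply: sumr_ge0 => c _; rewrite !(recolorC _ _ _ xy).
  by have [_ /(_ _ ai)/andP[]] := IH (recolor f y c) x.
have Sk : S <= k%:R.
  rewrite -[leRHS](_ : \sum_(c < k) 1 = _); last by rewrite sumr_const card_ord.
  apply: ler_sum => c _; rewrite !(recolorC _ _ _ xy).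
  by have [_ /(_ _ ai)/andP[]] := IH (recolor f y c) x.
rewrite mulr_ge0 ?invr_ge0 ?ler0n//=.
by rewrite mulrC ler_pdivrMr ?ltr0n// mul1r.
Qed.

(** The quadratic remainder is the source of the term [t ^+ 2 / k] in the moment bounds below. *)
Lemma expRN_le_quad (u : R) : 0 <= u -> expR (- u) <= 1 - u + u ^+ 2.
Proof.
move=> u0; rewrite expRN.
have u1 : 0 < 1 + u by lra.
apply: (@le_trans _ _ (1 + u)^-1).
  by rewrite lef_pV2 ?posrE ?expR_gt0// expR_ge1Dx.
rewrite -[leLHS]mul1r ler_pdivrMr//.
suff -> : (1 - u + u ^+ 2) * (1 + u) = 1 + u ^+ 3 by rewrite lerDl exprn_ge0.
ring.
Qed.

(** As the color of [x] varies, [F] is [c + d * B] with [B] a Bernoulli variable of bias [1 / k] and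
    [d] in [0, 1]. Only the random bit costs anything, so the error exponent carries the factor
    [1 / k]. *)
Lemma avg1_expR_le x i (t : R) F f : 0 <= t -> color_lipschitz i F ->
  avg1 x (fun g => expR (- t * F g)) f <=
  expR (t ^+ 2 / k%:R) * expR (- t * avg1 x F f).
Proof.
move=> t0 LF.
have [c [d [/andP[d0 d1] Fcd]]] : exists c d : R, 0 <= d <= 1 /\
    forall a, F (recolor f x a) = c + (a == i)%:R * d.
  have [L1 L2] := LF f x.
  have [/existsP[a ai]|] := boolP [exists a, a != i].
    exists (F (recolor f x a)), (F (recolor f x i) - F (recolor f x a)).
    split; first exact: L2.
    move=> b; have [->|bi] := eqVneq b i; first by rewrite mul1r addrC subrK.
    by rewrite mul0r addr0; apply: L1.
  (* Here [i] is the only color, so [F] is constant along [x] and [d = 0] serves. *)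
  rewrite negb_exists => /forallP noa.
  exists (F (recolor f x i)), 0; rewrite lexx ler01; split=> // a.
  by move/negPn/eqP: (noa a) => ->; rewrite mulr0 addr0.
set p := k%:R^-1 : R.
have p0 : 0 <= p by rewrite invr_ge0.
have sum_i (u v : R) : p * \sum_(a < k) (u + (a == i)%:R * v) = u + p * v.
  rewrite big_split/= sumr_const card_ord -[u *+ k]mulr_natl mulrDr mulKf//.
  rewrite -mulr_suml (bigD1 i)//= eqxx big1 ?addr0 ?mul1r// => a /negPf ->.
  by [].
have -> : avg1 x F f = c + p * d.
  by rewrite /avg1; under eq_bigr do rewrite Fcd; exact: sum_i.
have -> : avg1 x (fun g => expR (- t * F g)) f =
    expR (- t * c) * (1 + p * (expR (- (t * d)) - 1)).
  rewrite /avg1 mulrDr mulr1 mulrCA -sum_i; congr (_ * _).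
  apply: eq_bigr => a _; rewrite Fcd; case: eqP => _.
    by rewrite !mul1r mulrDr expRD mulNr mulNr; ring.
  by rewrite !mul0r !addr0.
rewrite [- t * (c + _)]mulrDr expRD mulrCA ler_wpM2l ?expR_ge0// -expRD.
apply: le_trans (expR_ge1Dx _) _; rewrite ler_expR.
have td : 0 <= t * d by rewrite mulr_ge0.
have := expRN_le_quad td => E2.
have d2 : (t * d) ^+ 2 <= t ^+ 2.
  by rewrite ler_sqr ?nnegrE// ler_piMr.
rewrite [t ^+ 2 / _]mulrC -/p [- t * _](_ : _ = p * - (t * d)); last by ring.
by rewrite -mulrDr ler_wpM2l//; lra.
Qed.

(** Martingale argument: the points of [s] are averaged out one at a time. Each partial average is
    again [color_lipschitz], so the one-point bound applies and costs one factor per point. *)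
Lemma avg_expR_le s i (t : R) F f : 0 <= t -> color_lipschitz i F ->
  avg s (fun g => expR (- t * F g)) f <=
  expR ((size s)%:R * (t ^+ 2 / k%:R)) * expR (- t * avg s F f).
Proof.
move=> t0 LF; elim: s f => [|x s IH] f /=.
  by rewrite mul0r expR0 mul1r.
apply: le_trans (avg1_le x IH f) _.
rewrite (_ : avg1 x _ f = expR ((size s)%:R * (t ^+ 2 / k%:R)) *
    avg1 x (fun g => expR (- t * avg s F g)) f); last first.
  by rewrite /avg1 -mulr_sumr mulrCA.
rewrite -natr1 mulrDl mul1r expRD -mulrA ler_wpM2l ?expR_ge0//.
by apply: avg1_expR_le (color_lipschitz_avg s LF).
Qed.

(* The Chernoff bound with parameter [e / 2]. *)
Lemma color_lipschitz_tail s i (e : R) F : 0 <= e -> color_lipschitz i F ->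
  mean (fun f => (F f < avg s F f - e * ((size s)%:R / k%:R))%R%:R) <=
  expR (- (e ^+ 2 / 4 * ((size s)%:R / k%:R))).
Proof.
move=> e0 LF; set q := (size s)%:R / k%:R.
set t := e / 2; have t0 : 0 <= t by rewrite divr_ge0.
(* Exponential Markov inequality: [G] dominates the indicator of the tail event. *)
pose G f := expR (- t * F f) * expR (t * (avg s F f - e * q)).
apply: (@le_trans _ _ (mean G)).
  apply: mean_le => f; rewrite /G -expRD.
  case: ltP => [lt|_]; last by rewrite expR_ge0.
  rewrite -expR0 ler_expR mulNr addrC -mulrBr mulr_ge0// subr_ge0.
  exact: ltW.
rewrite -(mean_avg s) -[leRHS]mean_cst; apply: mean_le => f.
(* The second factor ignores the colors in [s]. After the conditional means cancel, the exponent is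
   [t ^+ 2 * q - t * e * q], which is [- e ^+ 2 / 4 * q] at [t = e / 2]. *)
rewrite /G avg_mulr; last by move=> g x a xs; rewrite avg_recolor.
apply: le_trans (ler_wpM2r _ (avg_expR_le s f t0 LF)) _; first exact: expR_ge0.
rewrite -!expRD ler_expR le_eqVlt; apply/orP; left; apply/eqP.
by rewrite /q /t; field.
Qed.

End Resampling.

(** * Matchings in a fixed graph *)

Section Matchings.
Variable V : finType.
Implicit Types (E M N : {set {set V}}) (e : {set V}).

Lemma leq_MM E M : is_matching E M -> (#|M| <= MM E)%N.
Proof. exact: (@leq_bigmax_cond _ (is_matching E) (fun M => #|M|)). Qed.

Lemma maximum_matching_exists E : exists M, is_maximum_matching E M.
Proof.
have m0 : is_matching E finset.set0.
  rewrite /is_matching finset.sub0set; apply/finset.trivIsetP => A B.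
  by rewrite finset.inE.
have [|M mM cM] :=
    @eq_bigmax_cond _ (is_matching E) (fun M : {set {set V}} => #|M|).
  by apply/card_gt0P; exists finset.set0.
by exists M; apply/andP; split; [exact: mM | apply/eqP/esym].
Qed.

Lemma is_matchingS E M N : N \subset M -> is_matching E M -> is_matching E N.
Proof.
move=> NM /andP[ME tM]; rewrite /is_matching (fintype.subset_trans NM ME).
exact: finset.trivIsetS tM.
Qed.

Lemma MM_subset E E' : E \subset E' -> (MM E <= MM E')%N.
Proof.
move=> EE'; have [M /andP[/andP[ME tM] /eqP <-]] := maximum_matching_exists E.
by apply: leq_MM; rewrite /is_matching tM (fintype.subset_trans ME).
Qed.

Lemma MM_setU1 E e : (MM (e |: E)%SET <= (MM E).+1)%N.
Proof.
have [M /andP[/andP[ME tM] /eqP <-]] := maximum_matching_exists (e |: E)%SET.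
rewrite (finset.cardsD1 e) -add1n leq_add ?leq_b1//.
apply: leq_MM; rewrite /is_matching (finset.trivIsetS (finset.subD1set _ _) tM).
by rewrite finset.subDset ME.
Qed.

Lemma card_cover_matching E M : simple_graph E -> is_matching E M ->
  #|finset.cover M| = (2 * #|M|)%N.
Proof.
move=> /forall_inP sE /andP[/fintype.subsetP ME /eqP <-].
rewrite mulnC -sum_nat_const; apply: eq_bigr => e /ME /sE /eqP.
by [].
Qed.

Lemma card_matching_le E M : simple_graph E -> is_matching E M ->
  (#|M| <= #|V|)%N.
Proof.
move=> sE mM; apply: leq_trans (max_card (mem (finset.cover M))).
by rewrite (card_cover_matching sE mM) leq_pmull.
Qed.

(* Every vertex of [C] lies in at most one edge of [M]. *)
Lemma card_matching_disjoint E M (C : {set V}) : is_matching E M ->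
  (#|M| <= #|[set e in M | [disjoint e & C]]%SET| + #|C|)%N.
Proof.
move=> /andP[_ /finset.trivIsetP tM].
rewrite -(finset.cardsID [set e : {set V} | [disjoint e & C]]%SET M) leq_add//.
  by apply: subset_leq_card; apply/fintype.subsetP => e; rewrite !finset.inE.
set B := (_ :\: _)%SET.
have BP e : e \in B -> (e \in M) * (exists v, (v \in e) && (v \in C)).
  rewrite !finset.inE => /andP[eC ->]; split=> //.
  by have /pred0Pn[v vP] := eC; exists v.
(* Choose a vertex of [e] in [C], as a singleton so that the empty set can be the default value;
   edges of a matching share no vertex, so [h] is injective on [B]. *)
pose h e := if [pick v | (v \in e) && (v \in C)] is Some v then [set v]%SET
  else finset.set0.
have hP e : e \in B -> exists2 v, h e = [set v]%SET & (v \in e) && (v \in C).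
  move=> /BP[_ [v vP]]; rewrite /h; case: pickP => [u uP|/(_ v)].
    by exists u.
  by rewrite vP.
have h_inj : {in B &, injective h}.
  move=> e e' eB e'B; have [v -> /andP[ve _]] := hP _ eB.
  have [v' -> /andP[ve' _]] := hP _ e'B => /finset.set1_inj vv'; subst v'.
  apply/eqP/negPn/negP => ee'.
  have /pred0P/(_ v)/= := tM _ _ (BP _ eB).1 (BP _ e'B).1 ee'.
  by rewrite ve ve'.
rewrite -(finset.card_in_imset h_inj) -[leqRHS](finset.card_imset _ finset.set1_inj).
apply: subset_leq_card; apply/fintype.subsetP => _ /finset.imsetP[e eB ->].
have [v -> /andP[_ vC]] := hP _ eB.
exact: finset.imset_f.
Qed.

Lemma trivIset_setU_disjoint M N : finset.trivIset M -> finset.trivIset N ->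
  finset.trivIset (M :|: [set e in N | [disjoint e & finset.cover M]])%SET.
Proof.
move=> tM tN; apply: finset.trivIsetU => //.
  apply: finset.trivIsetS tN; apply/fintype.subsetP => e.
  by rewrite finset.inE => /andP[].
apply/bigcup_disjointP => e.
by rewrite finset.inE disjoint_sym => /andP[].
Qed.

End Matchings.

(** * Matchings in the parts of a random partition *)

Section RandomParts.
Variables (R : realType) (V : finType) (E : {set {set V}}) (k : nat).
Local Notation T := {e : {set V} | e \in E}.
Implicit Types (f : edge_assignment E k) (x : T) (i a : 'I_k).

Lemma mem_part f i x : (val x \in part f i) = (f x == i).
Proof.
apply/finset.imsetP/eqP => [[y]|fxi].
  by rewrite finset.inE => /eqP <- /val_inj ->.
by exists x => //; rewrite finset.inE fxi.
Qed.

Lemma part_sub f i : part f i \subset E.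
Proof. by apply/fintype.subsetP => _ /finset.imsetP[x _ ->]; exact: valP. Qed.

Lemma partP f i e : e \in part f i -> exists2 x, e = val x & f x = i.
Proof.
by move=> /finset.imsetP[x]; rewrite finset.inE => /eqP fx ->; exists x.
Qed.

Lemma part_recolor f x a i : part (recolor f x a) i =
  (if a == i then val x |: part f i else part f i :\ val x)%SET.
Proof.
apply/finset.setP => e; have [eE|eE] := boolP (e \in E); last first.
  have nE (g : edge_assignment E k) : e \in part g i = false.
    by apply/negbTE; apply: contra eE; apply/fintype.subsetP/part_sub.
  case: ifP => _; rewrite !finset.inE !nE ?andbF ?orbF//.
  by case: eqP => // ex; rewrite ex (valP x) in eE.
have -> : e = val (exist (fun e => e \in E) e eE) by [].
set y := exist _ _ _; rewrite mem_part ffunE.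
by case: (eqVneq a i) => ai; rewrite !finset.inE mem_part (inj_eq val_inj);
  case: (eqVneq y x) => //=; rewrite ?ai ?eqxx// (negPf ai).
Qed.

(** Moving an edge between two other parts leaves part [i] unchanged, and inserting one edge raises
    [MM] by 0 or 1. *)
Lemma color_lipschitz_MM_part i :
  color_lipschitz i (fun f : edge_assignment E k => (MM (part f i))%:R : R).
Proof.
move=> f x; split=> [a b /negPf ai /negPf bi|a /negPf ai].
  by rewrite !part_recolor ai bi.
rewrite !part_recolor ai eqxx.
have -> : (val x |: part f i = val x |: (part f i :\ val x))%SET.
  by apply/finset.setP => e; rewrite !finset.inE; case: eqP.
set P := (_ :\ _)%SET.
rewrite subr_ge0 ler_nat MM_subset ?finset.subsetUr//= lerBlDl natr1 ler_nat.
exact: MM_setU1.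
Qed.

Hypothesis k_gt0 : (0 < k)%N.
Hypothesis simpleE : simple_graph E.
Variable Mst : {set {set V}}.
Hypothesis maxMst : is_maximum_matching E Mst.

Definition edges_of : seq T := enum [set x : T | val x \in Mst]%SET.

Lemma card_sub_edges (A : {set {set V}}) : A \subset E ->
  #|[set x : T | val x \in A]%SET| = #|A|.
Proof.
move=> AE; rewrite -(finset.card_imset _ val_inj); congr #|pred_of_set _|.
apply/finset.setP => e; apply/finset.imsetP/idP => [[x]|eA].
  by rewrite finset.inE => xA ->.
by exists (exist _ e (fintype.subsetP AE _ eA)) => //; rewrite finset.inE.
Qed.

Let MstE : Mst \subset E. Proof. by case/andP: maxMst => /andP[]. Qed.

Lemma size_edges_of : size edges_of = MM E.
Proof.
have /andP[_ /eqP <-] := maxMst.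
by rewrite -(card_sub_edges MstE) cardE.
Qed.

(* [K] together with the edges of [Mst] avoiding it is a matching in [E];
   each of the latter has color [i] with probability [1 / k]. *)
Lemma avg_MM_part_ge f i (K : {set {set V}}) :
  is_matching (part f i) K -> [disjoint K & Mst] ->
  #|K|%:R + (MM E)%:R / k%:R - (2 * #|K|)%:R / k%:R <=
    avg edges_of (fun g : edge_assignment E k => (MM (part g i))%:R : R) f.
Proof.
move=> mK dKM.
have /andP[/andP[_ tM] /eqP cM] := maxMst.
have /andP[KP tK] := mK.
have KE : K \subset E := fintype.subset_trans KP (part_sub f i).
pose U := [set e in Mst | [disjoint e & finset.cover K]]%SET.
have UE : U \subset E.
  apply: fintype.subset_trans MstE.
  by apply/fintype.subsetP => e; rewrite finset.inE => /andP[].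
have tQ : finset.trivIset (K :|: U)%SET by exact: trivIset_setU_disjoint.
pose Q := [set x : T | val x \in K :|: U]%SET.
(* The edges of [K :|: U] colored [i] form a matching in part [i]. Their number is a sum of color
   indicators, so its conditional mean is explicit. *)
pose Qs (g : {ffun T -> 'I_k}) : R := \sum_(x in Q) (g x == i)%:R.
have QsP g : Qs g <= (MM (part g i))%:R.
  rewrite /Qs -natr_sum ler_nat.
  rewrite (_ : \sum_(x in Q) _ = #|[set x in Q | g x == i]%SET|)%N; last first.
    rewrite -sum1dep_card big_mkcondr/=.
    by apply: eq_bigr => x _; case: (g x == i).
  rewrite -(finset.card_imset _ val_inj); apply: leq_MM.
  apply/andP; split.
    apply/fintype.subsetP => _ /finset.imsetP[x + ->].
    by rewrite finset.inE mem_part => /andP[].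
  apply: finset.trivIsetS tQ; apply/fintype.subsetP => _ /finset.imsetP[x + ->].
  by rewrite !finset.inE => /andP[].
apply: le_trans (avg_le edges_of QsP f); rewrite /Qs avg_sum.
under eq_bigr do rewrite (avg_color R k_gt0).
have memS x : (x \in edges_of) = (val x \in Mst).
  by rewrite mem_enum finset.inE.
(* Edges of [K] lie outside [Mst], so they keep their color [i] and count 1; edges of [U] are
   resampled and count [1 / k]. *)
have -> : \sum_(x in Q) (if x \in edges_of then k%:R^-1 else (f x == i)%:R)
    = #|K|%:R + #|U|%:R / k%:R :> R.
  rewrite (bigID (fun x => x \in edges_of))/= addrC; congr (_ + _).
    rewrite (eq_bigr (fun=> 1)); last first.
      move=> x; rewrite memS !finset.inE => /andP[/orP[xK|/andP[->//]] /negPf ->].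
      by rewrite -mem_part (fintype.subsetP KP).
    rewrite sumr_const -(card_sub_edges KE); congr (_ *+ _).
    apply: eq_card => x; rewrite [LHS]unfold_in/= memS !finset.inE.
    have [xK|xK]/= := boolP (val x \in K); last by case: (val x \in Mst); rewrite /= ?andbF.
    by rewrite (disjointFr dKM xK).
  rewrite (eq_bigr (fun=> k%:R^-1)); last by move=> x /andP[_ ->].
  rewrite sumr_const -[LHS]mulr_natl -(card_sub_edges UE); congr (_%:R * _).
  apply: eq_card => x; rewrite [LHS]unfold_in/= memS !finset.inE.
  have [xM|xM]/= := boolP (val x \in Mst); last by rewrite andbF.
  by rewrite (disjointFl dKM xM) andbT.
(* It remains that [U] misses at most [2 * #|K|] edges of [Mst], one per vertex covered by [K]. *)
rewrite -addrA lerD2l -mulrBl ler_wpM2r ?invr_ge0// lerBlDr -natrD ler_nat.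
have mE : is_matching E K by rewrite /is_matching KE.
have /andP[mM _] := maxMst.
rewrite -(card_cover_matching simpleE mE) -cM.
exact: card_matching_disjoint mM.
Qed.

(** The deterministic half of the argument, for one partition without a large deviation. *)
Lemma MM_bigcup_ge f (t : R) (H : 'I_k -> {set {set V}}) :
  (forall i, avg edges_of (fun g : edge_assignment E k => (MM (part g i))%:R) f - t
     <= (MM (part f i))%:R) ->
  (forall i, is_maximum_matching (part f i) (H i)) ->
  (MM E)%:R - k%:R * t <= 3 * (MM (\bigcup_(i < k) H i)%SET)%:R.
Proof.
move=> Ht maxH; set h := MM (\bigcup_(i < k) H i)%SET.
have /andP[/andP[_ tM] _] := maxMst.
have mH i : is_matching (part f i) (H i) by case/andP: (maxH i).
have kR : (0 : R) < k%:R by rewrite ltr0n.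
(* [#|H i|] splits as [#|K|] plus the overlap with [Mst], and [#|K|] cancels against the same term
   of the conditional mean. The remaining [#|K|] is at most [h], as [K] is a matching in the
   union. *)
have step i : (MM E)%:R / k%:R - 2 * h%:R / k%:R - t <= #|(H i :&: Mst)%SET|%:R.
  pose K := (H i :\: Mst)%SET.
  have mK : is_matching (part f i) K := is_matchingS (finset.subsetDl _ _) (mH i).
  have dK : [disjoint K & Mst].
    by apply/pred0P => e /=; rewrite finset.inE; case: (e \in Mst); rewrite ?andbF.
  have Kh : (#|K| <= h)%N.
    apply: leq_MM; rewrite /is_matching; case/andP: mK => _ ->; rewrite andbT.
    apply: fintype.subset_trans (finset.subsetDl _ _) _.
    exact: (finset.bigcup_sup i).
  have := avg_MM_part_ge mK dK; have := Ht i.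
  have /andP[_ /eqP <-] := maxH i.
  rewrite -(finset.cardsID Mst (H i)) natrD -/K natrM.
  have : 2 * #|K|%:R / k%:R <= 2 * h%:R / k%:R :> R.
    by rewrite ler_wpM2r ?invr_ge0 ?(ltW kR)// ler_wpM2l ?ler_nat.
  lra.
(* The overlaps lie in distinct parts, hence are disjoint, and together they form a submatching of
   [Mst]. *)
have sumH : (\sum_(i < k) #|(H i :&: Mst)%SET| <= h)%N.
  pose B := (\bigcup_(i < k) H i :&: Mst)%SET.
  have BE : B \subset E by apply: fintype.subset_trans (finset.subsetIr _ _) MstE.
  apply: (@leq_trans #|B|); last first.
    apply: leq_MM; rewrite /is_matching finset.subsetIl/=.
    exact: finset.trivIsetS (finset.subsetIr _ _) tM.
  rewrite -(card_sub_edges BE) -sum1_card (partition_big f xpredT)//=.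
  apply: leq_sum => i _; rewrite sum1dep_card.
  rewrite -[leqRHS](finset.card_imset _ val_inj); apply: subset_leq_card.
  apply/fintype.subsetP => e; rewrite finset.inE => /andP[eH eM].
  have [x ex fx] : exists2 x, e = val x & f x = i.
    by apply: partP; case/andP: (mH i) => /fintype.subsetP + _; apply.
  rewrite ex finset.imset_f// !finset.inE fx eqxx -ex eM !andbT.
  by apply/finset.bigcupP; exists i.
have : \sum_(i < k) ((MM E)%:R / k%:R - 2 * h%:R / k%:R - t) <= h%:R.
  apply: le_trans (_ : (\sum_(i < k) #|(H i :&: Mst)%SET|)%:R <= _); last by rewrite ler_nat.
  by rewrite natr_sum ler_sum.
rewrite sumr_const card_ord -[X in X <= _]mulr_natl.
rewrite (_ : k%:R * _ = (MM E)%:R - 2 * h%:R - k%:R * t); last by field; rewrite gt_eqF.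
lra.
Qed.

(** Union bound over the [k] parts with [t = e * MM E / k]. The bad events do not mention [H], so
    every choice of maximum matchings is covered at once. *)
Lemma Pr_partition_good_ge (e : R) : 0 <= e ->
  1 - k%:R * expR (- (e ^+ 2 / 4 * ((MM E)%:R / k%:R))) <=
  Pr_partition R (fun f : edge_assignment E k =>
    [forall H : {ffun 'I_k -> {set {set V}}},
      [forall i, is_maximum_matching (part f i) (H i)] ==>
      ((1 - e) * (MM E)%:R <= 3 * (MM (\bigcup_(i < k) H i)%SET)%:R)]).
Proof.
move=> e0; set good := fun f => _.
pose F i (f : edge_assignment E k) := (MM (part f i))%:R : R.
pose bad i f := F i f < avg edges_of (F i) f - e * ((size edges_of)%:R / k%:R).
have -> : Pr_partition R good = mean (fun f => (good f)%:R : R).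
  rewrite /Pr_partition /mean big_mkcond/=; apply: eq_bigr => f _.
  by case: (good f); rewrite ?mulr1 ?mulr0.
have goodP f : 1 - \sum_(i < k) (bad i f)%:R <= (good f)%:R :> R.
  have [/existsP[i bi]|] := boolP [exists i, bad i f].
    apply: (@le_trans _ _ 0); last by rewrite ler0n.
    rewrite subr_le0 (bigD1 i)//= bi lerDl; apply: sumr_ge0 => j _; exact: ler0n.
  rewrite negb_exists => /forallP nbad.
  suff -> : good f by rewrite lerBlDr lerDl; apply: sumr_ge0 => j _; exact: ler0n.
  apply/forallP => H; apply/implyP => /forallP maxH.
  have := @MM_bigcup_ge f (e * ((size edges_of)%:R / k%:R)) H _ maxH.
  rewrite size_edges_of => /(_ _) le3; apply: le_trans (le3 _).
    rewrite le_eqVlt; apply/orP; left; apply/eqP; field.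
    by rewrite pnatr_eq0 -lt0n.
  by move=> i; have := nbad i; rewrite /bad -leNgt size_edges_of.
apply: le_trans (mean_le goodP).
have -> : mean (fun f => 1 - \sum_(i < k) (bad i f)%:R) =
    1 - \sum_(i < k) mean (fun f => (bad i f)%:R) :> R.
  rewrite -[X in _ = X - _](mean_cst T k_gt0 (1 : R)) /mean exchange_big/= -sumrB.
  by apply: eq_bigr => f _; rewrite mulrBr mulr_sumr.
rewrite lerD2l lerN2 -size_edges_of.
rewrite [leRHS](_ : _ = \sum_(i < k) expR (- (e ^+ 2 / 4 * ((size edges_of)%:R / k%:R)))).
  apply: ler_sum => i _; exact: (color_lipschitz_tail _ _ e0 (color_lipschitz_MM_part i)).
by rewrite sumr_const card_ord -[RHS]mulr_natl.
Qed.

End RandomParts.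

(** * The error term and the asymptotic bound *)

Lemma Pr_partition_sub (R : realType) (V : finType) (E : {set {set V}})
    (k : nat) (A B : pred (edge_assignment E k)) :
  (forall f, A f -> B f) -> Pr_partition R A <= Pr_partition R B.
Proof.
move=> AB; rewrite /Pr_partition [leLHS]big_mkcond [leRHS]big_mkcond/=.
apply: ler_sum => f _; have := AB f; case: (A f) => [->//|_].
by case: (B f) => //; apply: prodr_ge0 => x _; rewrite invr_ge0.
Qed.

Lemma fourth_root_gt (R : realType) (A x : R) : 0 <= A -> A ^+ 4 < x ->
  A < Num.sqrt (Num.sqrt x).
Proof.
move=> A0 Ax; rewrite -[ltLHS](ger0_norm A0) -sqrtr_sqr ltr_sqrt; last first.
  by rewrite sqrtr_gt0 (le_lt_trans _ Ax)// exprn_ge0.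
rewrite -[ltLHS](ger0_norm (exprn_ge0 2 A0)) -sqrtr_sqr -exprM ltr_sqrt//.
by rewrite (le_lt_trans _ Ax)// exprn_ge0.
Qed.

Lemma size_O_n_maximum_matching : size_O_n maximum_matching_alg.
Proof.
exists 1%N => V E H sE /andP[mH _].
by rewrite mul1n; exact: card_matching_le sE mH.
Qed.

Lemma returns_subgraph_maximum_matching : returns_subgraph maximum_matching_alg.
Proof.
move=> V E _; split; first exact: maximum_matching_exists.
by move=> H /andP[/andP[]].
Qed.

Local Open Scope classical_set_scope.
Local Open Scope ring_scope.

Theorem theorem3p1 (R : realType) (w : nat -> R)
    (w_infty : w n @[n --> \oo] --> +oo) :
  exists eps : nat -> R,
    [/\ eps n @[n --> \oo] --> (0 : R),
        randomized_composable_coreset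
          (fun (V : finType) (E : {set {set V}}) (k : nat) =>
             w #|V| * (k%:R * ln #|V|%:R) <= (MM E)%:R)
          (fun n => 3 + eps n)
          maximum_matching_alg
      & size_O_n maximum_matching_alg].
Proof.
(* The deviation parameter will be [(r n)^-1]. The fourth root makes it vanish while its square
   times [w n] is [r n ^+ 2], which still diverges. *)
pose r n : R := Num.sqrt (Num.sqrt (w n)).
have r_gt (A : R) : 0 <= A -> \forall n \near \oo, A < r n.
  move=> A0; have /cvgryPgt/(_ (A ^+ 4)) := w_infty.
  by apply: filterS => n; exact: fourth_root_gt.
(* With [d = (r n)^-1] at most 1/2, [3 / (1 - d)] is at most [3 + 6 * d]. *)
exists (fun n => 6 / r n); split; last exact: size_O_n_maximum_matching.
  apply/cvgrPdist_lt => e e0; have : 0 <= 6 / e by rewrite divr_ge0// ltW.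
  move=> /r_gt; apply: filterS => n rn.
  have r0 : 0 < r n by apply: le_lt_trans rn; rewrite divr_ge0// ltW.
  rewrite sub0r normrN ger0_norm ?divr_ge0 ?(ltW r0)//.
  by rewrite ltr_pdivrMr// mulrC -ltr_pdivrMr.
split; first exact: returns_subgraph_maximum_matching.
move=> c; near=> n => V E k cV sE k0 promise.
(* This gives both [r n ^+ 2 / 4 >= c.+1], for the failure probability, and [(r n)^-1 <= 1 / 2]. *)
have rn : 4 * c.+1%:R < r n by near: n; apply: r_gt.
have en : expR 1 <= n%:R :> R by near: n; exact: nbhs_infty_ger.
have c1 : 1 <= c.+1%:R :> R by rewrite ler1n.
have rpos : 0 < r n by lra.
have wE : w n = r n ^+ 4.
  have w0 : 0 < w n by move: rpos; rewrite !sqrtr_gt0.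
  by rewrite (exprM _ 2 2) sqr_sqrtr ?sqrtr_ge0// sqr_sqrtr// ltW.
have n0 : 0 < n%:R :> R := lt_le_trans (expR_gt0 1) en.
have ln1 : 1 <= ln n%:R :> R by rewrite -ler_expR lnK ?posrE.
have kR : 0 < k%:R :> R by rewrite ltr0n.
have [Mst maxM] := maximum_matching_exists E.
rewrite cV wE in promise.
(* The promise bounds [k] by [MM E], hence by [n]; this controls the factor [k] of the union
   bound. *)
have kn : k%:R <= n%:R :> R.
  apply: (@le_trans _ _ (MM E)%:R).
    apply: le_trans promise; rewrite mulrCA; apply: ler_peMr; first exact: ltW.
    by rewrite mulr_ege1// exprn_ege1//; lra.
  have /andP[mM /eqP <-] := maxM.
  by rewrite ler_nat -cV; exact: card_matching_le sE mM.
have rV0 : 0 <= (r n)^-1 by rewrite invr_ge0 ltW.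
have rV2 : (r n)^-1 <= 1 / 2.
  by rewrite div1r lef_pV2 ?posrE//; lra.
apply: le_trans (le_trans (Pr_partition_good_ge k0 sE maxM rV0) _); last first.
  apply: Pr_partition_sub => f /forallP good.
  apply/forallP => H; apply/implyP => maxH; have /implyP/(_ maxH) := good H.
  set m := (MM E)%:R; set h := (MM _)%:R => le3.
  have m0 : 0 <= m by exact: ler0n.
  have h0 : 0 <= h by exact: ler0n.
  rewrite ler_pdivrMr; last by lra.
  move: le3 rV0 rV2; set d := (r n)^-1 => le3 d0 d2.
  have d1 : 0 <= 1 + 2 * d by lra.
  apply: (@le_trans _ _ ((1 + 2 * d) * ((1 - d) * m))).
    rewrite -subr_ge0 (_ : _ - _ = d * (1 - 2 * d) * m); last by ring.
    by rewrite !mulr_ge0//; lra.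
  apply: le_trans (ler_wpM2l d1 le3) _.
  by rewrite le_eqVlt; apply/orP; left; apply/eqP; ring.
rewrite lerD2l lerN2.
(* Each part fails with probability at most [n] to the power [- c.+1]; the extra factor [n] pays for
   the union bound. *)
apply: (@le_trans _ _ (n%:R * expR (- (c.+1%:R * ln n%:R)))); last first.
  rewrite expRN expRM_natl lnK ?posrE// exprS invfM mulrA divff ?mul1r//.
  by rewrite gt_eqF.
rewrite ler_pM ?expR_ge0 ?(ltW kR)// ler_expR lerN2.
(* By the promise, [MM E / k] is at least [r n ^+ 4 * ln n]. *)
apply: (@le_trans _ _ ((r n)^-1 ^+ 2 / 4 * (r n ^+ 4 * ln n%:R))); last first.
  apply: ler_wpM2l; first by rewrite divr_ge0 ?exprn_ge0.
  by rewrite ler_pdivlMr// -mulrA [ln _ * _]mulrC.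
rewrite [leRHS](_ : _ = r n ^+ 2 / 4 * ln n%:R); last by field; rewrite gt_eqF.
apply: ler_wpM2r; first exact: le_trans ler01 ln1.
rewrite ler_pdivlMr// mulrC; apply: (le_trans (ltW rn)).
by rewrite expr2 ler_peMl ?ltW//; lra.
Unshelve. all: by end_near.
Qed.
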